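(* Let $\mathbb{K}$ be a field, $S=\mathbb{K}[x_1,\ldots,x_n]$ with $n\ge 6$, and let $I\subseteq S$ be a support-$2$ monomial ideal such that $G(I)=C_n$, the cycle on $x_1,\ldots,x_n$. Then the following are equivalent: (1) $I$ does not have any embedded associated primes; (2) $I$ has a standard linear weighting. Moreover, $I^{(s)}=I^s$ for all $s\ge 1$ if and only if $n$ is even and $I$ has a standard linear weighting.
   Context: For a monomial ideal $I$, $\mathcal{G}(I)$ denotes its minimal set of monomial generators. $I$ is a support-$2$ monomial ideal if $\mathcal{G}(I)\subseteq\{x_i^ax_j^b : 1\le i<j\le n,\ a,b\ge 1\}$. The underlying simple graph $G(I)$ has vertices $x_1,\ldots,x_n$ and an edge $\{x_i,x_j\}$ whenever some element of $\mathcal{G}(I)$ has support $\{x_i,x_j\}$; $\sqrt{I}$ is the edge ideal of $G(I)$. Symbolic power: $I^{(s)}=\bigcap_{P\in\mathrm{MinAss}(I)}(I^sS_P\cap S)$ over the minimal primes of $I$. A standard linear weighting is a map $w(a_1,\ldots,a_n)=(d_1a_1,\ldots,d_na_n)$ with fixed positive integers $d_i$; for a monomial ideal $J$, $J_w$ is generated by the monomials obtained from $\mathcal{G}(J)$ by replacing each $x_i$ by $x_i^{d_i}$. ''$I$ has a standard linear weighting'' means $I=(\sqrt{I})_w$ for some standard linear weighting $w$. *)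

(* Defs.v *)
From mathcomp Require Import all_boot all_algebra.
From mathcomp Require Import mpoly.
Set Implicit Arguments. Unset Strict Implicit. Unset Printing Implicit Defensive.
Import GRing.Theory.
Local Open Scope ring_scope.

Section Defs.
Variables (K : fieldType) (n : nat).
Local Notation S := {mpoly K[n]}.

Definition subI (I J : S -> Prop) := forall f, I f -> J f.
Definition eqI (I J : S -> Prop) := forall f, I f <-> J f.

Definition ideal_gen (A : S -> Prop) : S -> Prop :=
  fun f => exists (k : nat) (c g : 'I_k -> S),
      (forall i, A (g i)) /\ f = \sum_(i < k) c i * g i.

Definition is_ideal (I : S -> Prop) :=
  [/\ I 0, (forall f g, I f -> I g -> I (f + g)) & (forall r f, I f -> I (r * f))].

Definition monomials (A : 'X_{1..n} -> Prop) : S -> Prop :=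
  fun f => exists m, A m /\ f = 'X_[m].
Definition is_monomial_ideal (I : S -> Prop) :=
  exists A : 'X_{1..n} -> Prop, eqI I (ideal_gen (monomials A)).

Definition mingens (I : S -> Prop) (m : 'X_{1..n}) :=
  I 'X_[m] /\ forall m' : 'X_{1..n}, lem m' m -> I 'X_[m'] -> m' = m.

Definition support2 (I : S -> Prop) :=
  forall m, mingens I m -> exists i j : 'I_n,
    [/\ i != j, (0 < m i)%N, (0 < m j)%N &
        forall k, k != i -> k != j -> m k = 0%N].

Definition gedge (I : S -> Prop) (i j : 'I_n) :=
  i != j /\ exists m, mingens I m /\ (0 < m i)%N /\ (0 < m j)%N.

Definition cycle_edge (i j : 'I_n) :=
  (val j == (val i).+1 %% n)%N || (val i == (val j).+1 %% n)%N.

Definition graph_is_cycle (I : S -> Prop) :=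
  forall i j : 'I_n, gedge I i j <-> cycle_edge i j.

Definition radical (I : S -> Prop) : S -> Prop :=
  fun f => exists k : nat, I (f ^+ k).

Definition wmnm (d : 'I_n -> nat) (m : 'X_{1..n}) : 'X_{1..n} :=
  [multinom (d i * m i)%N | i < n].
Definition weighted (J : S -> Prop) (d : 'I_n -> nat) : S -> Prop :=
  ideal_gen (fun f => exists m, mingens J m /\ f = 'X_[wmnm d m]).

Definition has_std_lin_weighting (I : S -> Prop) :=
  exists d : 'I_n -> nat, (forall i, (0 < d i)%N) /\ eqI I (weighted (radical I) d).

Definition is_prime (P : S -> Prop) :=
  [/\ is_ideal P, ~ P 1 & forall a b, P (a * b) -> P a \/ P b].

Definition ass (I P : S -> Prop) :=
  is_prime P /\ exists f : S, forall g, P g <-> I (f * g).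

Definition minass (I P : S -> Prop) :=
  ass I P /\ forall Q, ass I Q -> subI Q P -> subI P Q.

Definition no_embedded_primes (I : S -> Prop) :=
  forall P, ass I P -> minass I P.

Fixpoint ideal_pow (I : S -> Prop) (s : nat) : S -> Prop :=
  match s with
  | 0 => fun _ => True
  | s'.+1 => ideal_gen (fun h => exists a b, ideal_pow I s' a /\ I b /\ h = a * b)
  end.

(* I^s S_P \cap S = { f | u f \in I^s for some u \notin P }. *)
Definition contr_loc (J P : S -> Prop) : S -> Prop :=
  fun f => exists u, ~ P u /\ J (u * f).

Definition symb_pow (I : S -> Prop) (s : nat) : S -> Prop :=
  fun f => forall P, minass I P -> contr_loc (ideal_pow I s) P f.

End Defs.

(* Main.v *)
Require Import Defs.
From mathcomp Require Import all_boot all_algebra.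
From mathcomp Require Import mpoly zify.
From Stdlib Require Import Classical ClassicalEpsilon.

(** For a monomial ideal [I] every associated prime is generated by a set [C] of
variables and is the colon ideal of a monomial; for a cycle ideal [C] is a vertex
cover, and the minimal primes are the irredundant vertex covers.

If [I] is the intersection of its localizations at the minimal primes, then a
monomial belongs to [I] as soon as it does so after setting the variables outside
each irredundant cover to 1. For [n >= 6] this forces the least exponent of a
variable to be the same on its two edges, and these exponents are the weights.

With weights [d], the symbolic power is governed by the numbers [m i %/ d i]: a
monomial lies in [I^(s)] when they sum to at least [s] over every vertex cover,
and in [I^s] when [s] edges can be packed below them. For even [n] these
agree by the weighted Koenig theorem; for odd [n] the product of all
['X_i ^+ d i] separates them at [s = (n + 1) / 2]. *)

Set Implicit Arguments. Unset Strict Implicit. Unset Printing Implicit Defensive.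
Import GRing.Theory.
Local Open Scope ring_scope.

Definition decb (P : Prop) : bool :=
  if excluded_middle_informative P then true else false.

Lemma decbP (P : Prop) : reflect P (decb P).
Proof. by rewrite /decb; case: excluded_middle_informative => h; constructor. Qed.

Lemma fin_bound (T : finType) (Q : T -> nat -> Prop) :
  (forall t, exists B, forall k, Q t k -> (k <= B)%N) ->
  exists B, forall t k, Q t k -> (k <= B)%N.
Proof.
move=> /fin_all_exists [F hF]; exists (\max_t F t) => t k /hF hk.
exact: leq_trans hk (leq_bigmax t).
Qed.

(** * Monomial ideals *)

Section MonomialIdeals.
Variables (K : fieldType) (n : nat).
Local Notation S := {mpoly K[n]}.
Implicit Types (I J P : S -> Prop) (f g u : S) (m v w : 'X_{1..n}) (C : {set 'I_n}).

Lemma ideal_gen_ideal (A : S -> Prop) : is_ideal (ideal_gen A).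
Proof.
split.
- by exists 0%N, (fun=> 0), (fun=> 0); split=> [[]//|]; rewrite big_ord0.
- move=> f g [k [c [a [Aa ->]]]] [l [c' [a' [Aa' ->]]]].
  exists (k + l)%N, (fun i => match split i with inl x => c x | inr y => c' y end),
    (fun i => match split i with inl x => a x | inr y => a' y end).
  split=> [i|]; first by case: split.
  rewrite big_split_ord /=; congr (_ + _); apply: eq_bigr => i _.
    by rewrite -[lshift l i]/(unsplit (inl i)) unsplitK.
  by rewrite -[rshift k i]/(unsplit (inr i)) unsplitK.
move=> r f [k [c [a [Aa ->]]]]; exists k, (fun i => r * c i), a; split=> //.
by rewrite mulr_sumr; apply: eq_bigr => i _; rewrite mulrA.
Qed.

Lemma ideal_gen_sub (A : S -> Prop) f : A f -> ideal_gen A f.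
Proof.
by move=> Af; exists 1%N, (fun=> 1), (fun=> f); rewrite big_ord1 mul1r.
Qed.

Lemma ideal_sum I (T : Type) (r : seq T) (Q : pred T) (F : T -> S) :
  is_ideal I -> (forall t, Q t -> I (F t)) -> I (\sum_(t <- r | Q t) F t).
Proof. by case=> I0 ID _ hF; elim/big_ind: _. Qed.

Lemma ideal_genE (A : S -> Prop) I : is_ideal I ->
  (forall f, A f -> I f) -> forall f, ideal_gen A f -> I f.
Proof.
move=> idI AI f [k [c [a [Aa ->]]]]; apply: ideal_sum => // i _.
by case: idI => _ _; apply; apply: AI.
Qed.

Lemma ideal_of_msupp I f : is_ideal I ->
  (forall m, m \in msupp f -> I 'X_[m]) -> I f.
Proof.
move=> idI h; rewrite [f]mpolyE big_seq; apply: ideal_sum => // m mf.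
by rewrite -mul_mpolyC; case: idI => _ _; apply; apply: h.
Qed.

Lemma ideal_lem I m m' : is_ideal I -> (m <= m')%MM -> I 'X_[m] -> I 'X_[m'].
Proof. by move=> [_ _ IM] /submK <- Im; rewrite mpolyXD; apply: IM. Qed.

Lemma msuppM_ex f g m : m \in msupp (f * g) ->
  exists m1 m2, [/\ m1 \in msupp f, m2 \in msupp g & m = (m1 + m2)%MM].
Proof. by move/msuppM_le/allpairsP => [[a b] /= [? ? ->]]; exists a, b. Qed.

Lemma msuppMX_in f m w : w \in msupp f -> (m + w)%MM \in msupp (f * 'X_[m]).
Proof. by rewrite !mcoeff_msupp mcoeffMX. Qed.

Lemma msupp_sum_ex (k : nat) (F : 'I_k -> S) m :
  m \in msupp (\sum_(i < k) F i) -> exists i, m \in msupp (F i).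
Proof.
move=> h; apply: NNPP => no; move: h; rewrite mcoeff_msupp raddf_sum big1 ?eqxx //=.
move=> i _; apply/eqP/negPn/negP; rewrite -mcoeff_msupp => mi.
by apply: no; exists i.
Qed.

Lemma ideal_gen_monomials (A : 'X_{1..n} -> Prop) f :
  ideal_gen (monomials A) f <->
  (forall m, m \in msupp f -> exists a, A a /\ (a <= m)%MM).
Proof.
split=> [[k [c [g [Ag ->]]]] m /msupp_sum_ex [i]|h].
  have [a [Aa ->]] := Ag i; move/msuppM_ex => [m1 [m2 [_ + ->]]].
  by rewrite msuppX inE => /eqP ->; exists a; rewrite lem_addl.
apply: ideal_of_msupp; first exact: ideal_gen_ideal.
move=> m /h [a [Aa le]]; apply: ideal_lem le _; first exact: ideal_gen_ideal.
by apply: ideal_gen_sub; exists a.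
Qed.

Lemma monomial_ideal_ideal I : is_monomial_ideal I -> is_ideal I.
Proof.
move=> [A /= h]; have [I0 ID IM] := ideal_gen_ideal (monomials A).
split; first exact/h.
  by move=> f g /h f1 /h g1; apply/h; apply: ID.
by move=> r f /h f1; apply/h; apply: IM.
Qed.

Lemma monomial_ideal_msupp I f m :
  is_monomial_ideal I -> I f -> m \in msupp f -> I 'X_[m].
Proof.
move=> [A h] /h /ideal_gen_monomials hf /hf [a [Aa le]].
by apply/h/ideal_gen_monomials => m'; rewrite msuppX inE => /eqP ->; exists a.
Qed.

Lemma mingens_ex I m : I 'X_[m] -> exists g : 'X_{1..n}, mingens I g /\ (g <= m)%MM.
Proof.
have [k] := ubnP (mdeg m); elim: k m => // k IH m ltk Im.
have [[m' [le Im' ne]]|no] := classic (exists m', [/\ (m' <= m)%MM, I 'X_[m'] & m' <> m]).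
  have ltd : (mdeg m' < mdeg m)%N.
    have := submK le; have [->|+ <-] := eqVneq (m - m')%MM 0%MM.
      by rewrite add0m => /ne.
    by rewrite -mdeg_eq0 mdegD; lia.
  have [g [mg leg]] := IH m' (leq_trans ltd ltk) Im'.
  by exists g; split=> //; apply: lepm_trans leg le.
exists m; rewrite lepm_refl; split=> //; split=> // m' le Im'.
by apply: NNPP => ne; apply: no; exists m'.
Qed.

Definition mrestrict (q : pred 'X_{1..n}) f : S :=
  \sum_(m <- msupp f | q m) f@_m *: 'X_[m].

Lemma mcoeff_mrestrict q f m : (mrestrict q f)@_m = if q m then f@_m else 0.
Proof.
rewrite /mrestrict raddf_sum /=.
under eq_bigr => k _ do rewrite mcoeffZ mcoeffX.
have [mf|mf] := boolP (m \in msupp f); last first.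
  rewrite (memN_msupp_eq0 mf) if_same big_seq_cond big1 // => k /andP[kf _].
  by case: eqP => [E|]; rewrite ?mulr0 //; rewrite -E kf in mf.
rewrite -big_filter; case: ifP => qm.
  rewrite (bigD1_seq m) ?mem_filter ?qm ?filter_uniq ?msupp_uniq //= eqxx mulr1.
  by rewrite big1 ?addr0 // => k /negPf ->; rewrite mulr0.
rewrite big_seq big1 // => k; rewrite mem_filter => /andP[qk _].
by case: eqP => [E|]; rewrite ?mulr0 //; rewrite -E qk in qm.
Qed.

Lemma msupp_mrestrict q f m :
  (m \in msupp (mrestrict q f)) = q m && (m \in msupp f).
Proof. by rewrite !mcoeff_msupp mcoeff_mrestrict; case: (q m); rewrite ?eqxx. Qed.

Lemma msupp_sub_mrestrict q f m :
  (m \in msupp (f - mrestrict q f)) = ~~ q m && (m \in msupp f).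
Proof.
by rewrite !mcoeff_msupp mcoeffB mcoeff_mrestrict; case: (q m);
  rewrite ?subrr ?subr0 ?eqxx.
Qed.

(** The monomials outside the prime generated by [C]; they become units when localizing there. *)
Definition off C v := forall i, i \in C -> v i = 0%N.

(* Compare, in [u * f], the lowest homogeneous parts with respect to the degree in the
   variables of [C]. *)
Lemma mul_off_saturated (q : pred 'X_{1..n}) C f u :
  (forall m v, q m -> q (m + v)%MM) ->
  (forall m v, m \in msupp f -> off C v -> q (m + v)%MM -> q m) ->
  (forall m, m \in msupp (u * f) -> q m) ->
  (exists v, v \in msupp u /\ off C v) ->
  forall m, m \in msupp f -> q m.
Proof.
move=> qup qsat quf [v0 [v0u offv0]] m0 m0f; apply: contraT => nqm0.
pose deg m := (\sum_(i in C) m i)%N.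
have degD a b : deg (a + b)%MM = (deg a + deg b)%N.
  by rewrite /deg -big_split /=; apply: eq_bigr => i _; rewrite mnmDE.
have deg0 v : deg v = 0%N <-> off C v.
  rewrite /deg; split=> [/eqP|h]; last by rewrite big1 // => i /h.
  by rewrite sum_nat_eq0 => /forallP h i iC; apply/eqP; move: (h i); rewrite iC.
have exk : exists k, has (fun m => ~~ q m && (deg m == k)) (msupp f).
  by exists (deg m0); apply/hasP; exists m0; rewrite // nqm0 eqxx.
case: (ex_minnP exk) => k /hasP [m1 m1f /andP[nqm1 /eqP degm1]] kmin.
pose f0 := mrestrict (fun m => ~~ q m && (deg m == k)) f.
pose u0 := mrestrict (fun m => deg m == 0%N) u.
have f0N : f0 != 0.
  by rewrite -msupp_eq0; apply/eqP => E; have := msupp_mrestrict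
    (fun m => ~~ q m && (deg m == k)) f m1; rewrite -/f0 E in_nil nqm1 degm1 eqxx m1f.
have u0N : u0 != 0.
  rewrite -msupp_eq0; apply/eqP => E; have := msupp_mrestrict
    (fun m => deg m == 0%N) u v0; rewrite -/u0 E in_nil v0u.
  by have/deg0 -> := offv0.
have : u0 * f0 != 0 by rewrite mulf_neq0.
rewrite -msupp_eq0; case Es: (msupp _) => [//|x s] _.
have xin : x \in msupp (u0 * f0) by rewrite Es inE eqxx.
have [v [m [vu0 mf0 Ex]]] := msuppM_ex xin.
move: vu0 mf0; rewrite !msupp_mrestrict => /andP[/eqP dv vu] /andP[/andP[nqm /eqP dm] mf].
have nqx : ~~ q x.
  by apply: contra nqm; rewrite Ex addmC; apply: qsat => //; apply/deg0.
have dx : deg x = k by rewrite Ex degD dv dm.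
have : x \in msupp (u * f).
  (* No other product of terms contributes to [x]. Those of [(u - u0) * f0] have degree above [k] in
     the variables of [C]. Those of [u * (f - f0)] either satisfy [q] or, by minimality of [k], have
     degree above [k]. *)
  have -> : u * f = u0 * f0 + ((u - u0) * f0 + u * (f - f0)).
    by rewrite mulrBl mulrBr addrA [u0 * f0 + _]addrC subrK addrC subrK.
  rewrite mcoeff_msupp mcoeffD [X in _ + X](_ : _ = 0) ?addr0 -?mcoeff_msupp //.
  apply/eqP; rewrite mcoeff_eq0; apply/negP => /msuppD_le; rewrite mem_cat => /orP[].
    move=> /msuppM_ex [a [b [+ + E]]]; rewrite msupp_sub_mrestrict msupp_mrestrict.
    move=> /andP[da _] /andP[/andP[_ /eqP db] _]; move: dx; rewrite E degD db.
    by move/eqP; rewrite -{2}[k]add0n eqn_add2r (negPf da).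
  move=> /msuppM_ex [a [b [_ + E]]]; rewrite msupp_sub_mrestrict.
  have [qb|nqb] /= := boolP (q b).
    by move: nqx; rewrite E addmC qup.
  move=> /andP[db bf].
  have : (k <= deg b)%N by apply: kmin; apply/hasP; exists b; rewrite // nqb eqxx.
  by move: dx db; rewrite E degD; clear; lia.
by move/quf; rewrite (negPf nqx).
Qed.

End MonomialIdeals.

(** * Associated primes *)

Section AssociatedPrimes.
Variables (K : fieldType) (n : nat).
Local Notation S := {mpoly K[n]}.
Implicit Types (I J P : S -> Prop) (f g u : S) (m v w : 'X_{1..n}) (C : {set 'I_n}).

(** The ideal generated by the variables in [C], given through supports so that membership is tested
    one monomial at a time. *)
Definition var_prime C : S -> Prop :=
  fun f => forall v, v \in msupp f -> exists2 i, i \in C & (0 < v i)%N.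

Lemma var_prime_ideal C : is_ideal (var_prime C).
Proof.
split=> [v|f g hf hg v|r f hf v]; first by rewrite msupp0.
  by move/msuppD_le; rewrite mem_cat => /orP[/hf|/hg].
by case/msuppM_ex => a [b [_ /hf [i iC bi] ->]]; exists i; rewrite // mnmDE ltn_addl.
Qed.

Lemma var_primeX C m : var_prime C 'X_[m] <-> exists2 i, i \in C & (0 < m i)%N.
Proof.
split=> [h|h v]; first by apply: h; rewrite msuppX inE eqxx.
by rewrite msuppX inE => /eqP ->.
Qed.

Lemma var_primeXi C i : var_prime C 'X_i <-> i \in C.
Proof.
rewrite var_primeX; split=> [[j jC]|iC]; last by exists i; rewrite // mnm1E eqxx.
by rewrite mnm1E; case: eqP => // ->.
Qed.

Lemma not_var_prime C f : ~ var_prime C f <-> exists v, v \in msupp f /\ off C v.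
Proof.
split=> [h|[v [vf ov]] /(_ _ vf) [i /ov ->] //].
apply: NNPP => no; apply: h => v vf; apply: NNPP => no'; apply: no.
exists v; split=> // i iC; apply/eqP; rewrite -leqn0 leqNgt; apply/negP => lt.
by apply: no'; exists i.
Qed.

(** Divisibility by a variable of [C] is unaffected by factors off [C], and a polynomial outside the
    ideal has a monomial off [C]; [mul_off_saturated] then gives primality. *)
Lemma var_prime_prime C : is_prime (var_prime C).
Proof.
split; first exact: var_prime_ideal.
  by apply/not_var_prime; exists 0%MM; rewrite msupp1 inE eqxx; split=> // i; rewrite mnm0E.
move=> a b ab; have [|na] := classic (var_prime C a); [by left | right].
pose q m := decb (exists2 i, i \in C & (0 < m i)%N).
suff h : forall m, m \in msupp b -> q m by move=> m /h /decbP.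
apply: (@mul_off_saturated _ _ q C _ a).
- by move=> m v /decbP [i iC mi]; apply/decbP; exists i; rewrite // mnmDE ltn_addr.
- move=> m v _ ov /decbP [i iC]; rewrite mnmDE (ov _ iC) addn0 => mi.
  by apply/decbP; exists i.
- by move=> m /ab h; apply/decbP.
exact/not_var_prime.
Qed.

Lemma prime_off_mono P C m : is_prime P -> (forall i, P 'X_i -> i \in C) ->
  off C m -> ~ P 'X_[m].
Proof.
move=> [_ P1 PM] hC om; rewrite mpolyXE_id; apply: (big_ind (fun f => ~ P f)) => //.
  by move=> a b Pa Pb /PM [].
move=> i _; elim: (m i) (om i) => [|k IH] h; first by rewrite expr0.
have iC : i \notin C by apply/negP => /h.
rewrite exprS => /PM [/hC|]; first exact/negP.
by apply: IH => iC'; rewrite iC' in iC.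
Qed.

(** An exponent of at least [D] acts as an infinite one: no minimal generator asks for more. *)
Definition exponent_bound I (D : nat) := forall m, mingens I m -> forall i, (m i <= D)%N.

(* The minimal generators supported on a fixed pair of variables form an antichain in
   [nat * nat]. *)
Lemma support2_exponent_bound I : support2 I -> exists D, exponent_bound I D.
Proof.
move=> s2; pose on i j m := mingens I m /\ forall k, k != i -> k != j -> m k = 0%N.
have cmp i j m m' : on i j m -> on i j m' -> (m i <= m' i)%N -> (m j <= m' j)%N -> m = m'.
  move=> [[Im _] zm] [[_ mm'] zm'] li lj; apply: mm' => //; apply/mnm_lepP => k.
  have [->//|ki] := eqVneq k i; have [->//|kj] := eqVneq k j.
  by rewrite zm // zm'.
have onC i j m : on i j m -> on j i m by case=> ? h; split=> // k ? ?; apply: h.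
(* By the antichain property, each exponent of [i] occurs in at most one generator on [i], [j]. *)
have strip i j N : exists B, forall m, on i j m -> (m i <= N)%N -> (m j <= B)%N.
  elim: N => [|N [B hB]].
    have [[m0 [o0 z0]]|no] := classic (exists m, on i j m /\ m i = 0%N).
      exists (m0 j) => m om; rewrite leqn0 => /eqP mi.
      rewrite leqNgt; apply/negP => lt.
      have E : m0 = m by apply: (cmp i j _ _ _ _ _ (ltnW lt)); rewrite // mi z0.
      by rewrite E ltnn in lt.
    by exists 0%N => m om; rewrite leqn0 => /eqP mi; case: no; exists m.
  have [[m0 [o0 z0]]|no] := classic (exists m, on i j m /\ m i = N.+1).
    exists (maxn B (m0 j)) => m om; rewrite leq_eqVlt ltnS => /orP[/eqP mi|]; last first.
      by move/(hB _ om) => ?; rewrite leq_max; apply/orP; left.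
    rewrite leq_max orbC leqNgt; case: ltnP => //= lt.
    have E : m0 = m by apply: (cmp i j _ _ _ _ _ (ltnW lt)); rewrite // mi z0.
    by rewrite E ltnn in lt.
  exists B => m om; rewrite leq_eqVlt ltnS => /orP[/eqP mi|]; last exact: hB.
  by case: no; exists m.
have pair i j : exists B, forall m, on i j m -> (m i <= B)%N /\ (m j <= B)%N.
  have [[m0 o0]|no] := classic (exists m, on i j m); last first.
    by exists 0%N => m om; case: no; exists m.
  have [B hB] := strip i j (m0 i); have [B' hB'] := strip j i (m0 j).
  (* A generator either lies in one of the two strips bounded by [m0], or dominates [m0] and
     therefore equals it. *)
  exists (m0 i + m0 j + B + B')%N => m om.
  have [li|/ltnW li] := leqP (m i) (m0 i).
    by have := hB _ om li; split; lia.
  have [lj|/ltnW lj] := leqP (m j) (m0 j).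
    by have := hB' _ (onC _ _ _ om) lj; split; lia.
  by rewrite -(cmp _ _ _ _ o0 om li lj); split; lia.
have [] := @fin_bound ('I_n * 'I_n)%type (fun t k => exists m, on t.1 t.2 m /\ (k = m t.1 \/ k = m t.2)).
  move=> [i j]; have [B hB] := pair i j; exists B => k [m [/hB [? ?]]] /=.
  by case=> ->.
move=> D hD; exists D => m mg k; have [i [j [_ _ _ z]]] := s2 _ mg.
have om : on i j m by [].
have [->|ki] := eqVneq k i; first by apply: (hD (i, j)); exists m; split=> //; left.
have [->|kj] := eqVneq k j; first by apply: (hD (i, j)); exists m; split=> //; right.
by rewrite z.
Qed.

(* Encodes that the colon ideal of ['X_[w]] is generated by the variables in [C]: beyond
   the bound [D], raising an exponent does not affect membership in [I]. *)
Definition ass_witness I D C w :=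
  [/\ ~ I 'X_[w], (forall i, i \in C -> I 'X_[w + U_(i)]) &
      (forall i, i \notin C -> (D <= w i)%N)].

(** A generator dividing the product already divides ['X_[w]]: on [C] the factor [v] vanishes, and
    off [C] the exponents of [w] exceed every generator. *)
Lemma not_ideal_add_off I D C w v : is_ideal I -> exponent_bound I D ->
  ~ I 'X_[w] -> (forall i, i \notin C -> (D <= w i)%N) -> off C v -> ~ I 'X_[w + v].
Proof.
move=> idI bD nIw Dw ov /mingens_ex [g [mg /mnm_lepP le]].
apply: nIw; case: (mg) => Ig _; apply: ideal_lem Ig => //; apply/mnm_lepP => i.
have [iC|iC] := boolP (i \in C); last exact: leq_trans (bD _ mg i) (Dw _ iC).
by move: (le i); rewrite mnmDE (ov _ iC) addn0.
Qed.

Lemma ass_witness_ass I D C w : is_monomial_ideal I -> exponent_bound I D ->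
  ass_witness I D C w -> ass I (var_prime C).
Proof.
move=> monI bD [nIw Iw Dw]; have idI := monomial_ideal_ideal monI.
split; first exact: var_prime_prime.
exists 'X_[w] => g; split=> [hg|Ig].
  apply: ideal_of_msupp => // m; rewrite mulrC => /msuppM_ex [a [b [/hg [i iC ai]]]].
  rewrite msuppX inE => /eqP -> ->; apply: ideal_lem (Iw _ iC) => //.
  apply/mnm_lepP => k; rewrite !mnmDE mnm1E addnC leq_add2r.
  by case: eqP => // <-.
apply: NNPP => /not_var_prime [v [vg ov]].
apply: (not_ideal_add_off idI bD nIw Dw ov).
by apply: monomial_ideal_msupp monI Ig _; rewrite mulrC; apply: msuppMX_in.
Qed.

(** Greedy: raise exponents below [D] as long as the monomial stays outside [I]. The total deficit
    to [D] decreases, and at the end the variables that still fall short of [D] all multiply into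
    [I]. *)
Lemma ass_witness_ex I D m : ~ I 'X_[m] ->
  exists C w, ass_witness I D C w /\ (m <= w)%MM.
Proof.
have [k] := ubnP (\sum_i (D - m i))%N; elim: k m => // k IH m ltk nIm.
have [[i [lt nI]]|no] := classic (exists i, (m i < D)%N /\ ~ I 'X_[m + U_(i)]).
  have [|C [w [aw le]]] := IH (m + U_(i))%MM _ nI.
    rewrite (leq_trans _ (ltnSE ltk)) // (bigD1 i) //= [ltnRHS](bigD1 i) //=.
    rewrite mnmDE mnm1E eqxx -addSn leq_add //; first by lia.
    by apply: leq_sum => j _; rewrite mnmDE leq_sub2l ?leq_addr.
  by exists C, w; split=> //; apply: lepm_trans le; apply: lem_addr.
exists [set i | decb (I 'X_[m + U_(i)])], m; rewrite lepm_refl; split=> //; split=> //.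
  by move=> i; rewrite inE => /decbP.
move=> i; rewrite inE => /decbP nI; rewrite leqNgt; apply/negP => lt.
by apply: no; exists i.
Qed.

(* Multiply the polynomial witness by a large monomial in the variables outside [P]; any
   monomial of the product outside [I] is then a witness. *)
Lemma ass_var_prime I D P : is_monomial_ideal I -> exponent_bound I D -> ass I P ->
  exists C w, eqI P (var_prime C) /\ ass_witness I D C w.
Proof.
move=> monI bD [primeP [f Pf]]; have idI := monomial_ideal_ideal monI.
have [idP P1 PM] := primeP.
pose C := [set i | decb (P 'X_i)].
have PC i : P 'X_i <-> i \in C by rewrite inE; split=> /decbP.
pose e := [multinom (if i \in C then 0 else D)%N | i < n].
have oe : off C e by move=> i iC; rewrite mnmE iC.
have ePn : ~ P 'X_[e] by apply: (prime_off_mono primeP _ oe) => i /PC.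
pose f' := f * 'X_[e].
have nIf' : ~ I f' by move/Pf.
have f'D m : m \in msupp f' -> forall i, i \notin C -> (D <= m i)%N.
  move/msuppM_ex => [a [b [_ + ->]]]; rewrite msuppX inE => /eqP -> i iC.
  by rewrite mnmDE mnmE (negPf iC) leq_addl.
have [w [wf' nIw]] : exists w, w \in msupp f' /\ ~ I 'X_[w].
  apply: NNPP => no; apply: nIf'; apply: ideal_of_msupp => // m mf'.
  by apply: NNPP => nI; apply: no; exists m.
exists C, w; split; last first.
  split=> //; last exact: f'D.
  move=> i /PC/Pf Ifi; apply: (@monomial_ideal_msupp _ _ _ (f' * 'X_i)) => //.
    by rewrite /f' mulrAC mulrC; case: idI => _ _; apply.
  by rewrite addmC; apply: msuppMX_in.
move=> g; split=> [Pg|hg]; last first.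
  apply: ideal_of_msupp => // m /hg [i /PC PXi mi].
  by apply: ideal_lem PXi => //; rewrite lep1mP -lt0n.
apply: NNPP => /not_var_prime ng; apply: nIw; apply/decbP.
(* The exponents of [f'] off [C] are at least [D], so membership in [I] is insensitive to factors
   off [C], while [g] has a monomial off [C]. *)
apply: (@mul_off_saturated _ _ (fun m => decb (I 'X_[m])) C f' g) => //.
- by move=> m v /decbP Im; apply/decbP; apply: ideal_lem Im => //; apply: lem_addr.
- move=> m v mf' ov /decbP Imv; apply/decbP; apply: NNPP => nI.
  exact: (not_ideal_add_off idI bD nI (f'D _ mf') ov).
move=> m mgf; apply/decbP; apply: monomial_ideal_msupp monI _ mgf.
have [_ _ IM] := idI; rewrite /f' mulrA mulrC; apply: IM.
by rewrite mulrC; apply/Pf.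
Qed.

End AssociatedPrimes.

(** * Cycles and their vertex covers *)

Definition vertex_cover (T : finType) (e : rel T) (C : {set T}) :=
  forall i j, e i j -> i \in C \/ j \in C.

Section CycleGraph.
Variable n : nat.
Implicit Types (i j : 'I_n) (C : {set 'I_n}).

(** Removes the remainder modulo [n], leaving a form fit for linear arithmetic. *)
Lemma cycle_edgeE i j : cycle_edge i j =
  [|| (j == i.+1 :> nat), (i.+1 == n) && (j == 0 :> nat),
      (i == j.+1 :> nat) | (j.+1 == n) && (i == 0 :> nat)]%N.
Proof.
have succE (a b : 'I_n) : (b == a.+1 %% n :> nat)%N
    = ((b == a.+1 :> nat) || (a.+1 == n) && (b == 0 :> nat))%N.
  have ltb := ltn_ord b; have := ltn_ord a; rewrite leq_eqVlt => /orP[/eqP E|lt].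
    rewrite E modnn eqxx /=; move: ltb; case: (_ =P n) => [->|_]; by rewrite ?ltnn ?orbF /=.
  by rewrite modn_small // [_ == n]ltn_eqF ?orbF.
by rewrite /cycle_edge !succE !orbA.
Qed.

Lemma cycle_edge_sym i j : cycle_edge i j -> cycle_edge j i.
Proof. by rewrite /cycle_edge orbC. Qed.

Lemma cycle_edge_neq i j : (1 < n)%N -> cycle_edge i j -> i != j.
Proof.
move=> n1; rewrite cycle_edgeE => h; apply/eqP => E; move: h; rewrite E.
by have := ltn_ord j; lia.
Qed.

(* Continues the path [i0, i1, i2] to [i0, ..., i4]; for [n >= 6] the last vertex is not adjacent to [i0]. *)
Lemma cycle_extend_path i0 i1 i2 : (6 <= n)%N ->
  cycle_edge i1 i0 -> cycle_edge i1 i2 -> i0 != i2 ->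
  exists i3 i4, [/\ cycle_edge i3 i4, (forall j, cycle_edge i2 j -> j = i1 \/ j = i3),
    i4 != i0, i4 != i1 & ~~ cycle_edge i4 i0 && ~~ cycle_edge i4 i1].
Proof.
move=> n6; rewrite !cycle_edgeE -val_eqE /=.
have h0 := ltn_ord i0; have h1 := ltn_ord i1; have h2 := ltn_ord i2.
(* Successor and predecessor on the cycle; the path may run in either direction. *)
pose s (k : nat) : nat := if (k.+1 == n)%N then 0%N else k.+1.
pose t (k : nat) : nat := if (k == 0)%N then n.-1 else k.-1.
have hs k : (k < n)%N -> (s k < n)%N by rewrite /s; case: eqP; lia.
have ht k : (k < n)%N -> (t k < n)%N by rewrite /t; case: eqP; lia.
move=> e0 e2 ne; have [E|E] : val i2 = s i1 \/ val i2 = t i1.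
  by move: e2; rewrite /s /t /=; do !case: eqP => /=; lia.
- exists (Ordinal (hs _ h2)), (Ordinal (hs _ (hs _ h2))).
  split; rewrite -?val_eqE ?cycle_edgeE /=.
  + by move: E; rewrite /s /=; do !case: ifP => /=; lia.
  + move=> j; rewrite cycle_edgeE => hj; have lj := ltn_ord j.
    suff : val j = val i1 \/ val j = s i2 by case=> ?; [left | right]; apply: val_inj.
    by move: E; rewrite /s /=; do !case: ifP => /=; lia.
  + by move: E; rewrite /s /=; do !case: ifP => /=; lia.
  + by move: E; rewrite /s /=; do !case: ifP => /=; lia.
  by move: E; rewrite /s /=; do !case: ifP => /=; lia.
- exists (Ordinal (ht _ h2)), (Ordinal (ht _ (ht _ h2))).
  split; rewrite -?val_eqE ?cycle_edgeE /=.
  + by move: E; rewrite /t /=; do !case: ifP => /=; lia.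
  + move=> j; rewrite cycle_edgeE => hj; have lj := ltn_ord j.
    suff : val j = val i1 \/ val j = t i2 by case=> ?; [left | right]; apply: val_inj.
    by move: E; rewrite /t /=; do !case: ifP => /=; lia.
  + by move: E; rewrite /t /=; do !case: ifP => /=; lia.
  + by move: E; rewrite /t /=; do !case: ifP => /=; lia.
  by move: E; rewrite /t /=; do !case: ifP => /=; lia.
Qed.

Local Notation cover := (vertex_cover (@cycle_edge n)).

Definition irredundant C := forall i, i \in C -> exists2 j, cycle_edge i j & j \notin C.

(** Double counting: each of the [n] edges from [i] to [ordS i] meets [C], and each vertex lies on
    two of them. *)
Lemma cover_card C : cover C -> (n <= #|C|.*2)%N.
Proof.
move=> cC; have sumC : (\sum_i (i \in C) = #|C|)%N.
  by rewrite -sum1_card [RHS]big_mkcond; apply: eq_bigr => i _; case: (i \in C).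
have -> : (#|C|.*2 = \sum_i ((i \in C) + (ordS i \in C)))%N.
  by rewrite big_split /= sumC -addnn -{2}sumC [in LHS](reindex_inj (@ordS_inj n)).
rewrite -[leqLHS]card_ord -sum1_card; apply: leq_sum => i _.
have [|->|->] := cC i (ordS i); rewrite ?addn1 ?addn_gt0 ?orbT //.
by rewrite /cycle_edge /= eqxx.
Qed.

End CycleGraph.

(** * Ideals of cycles *)

Section EqualIdeals.
Variables (K : fieldType) (n : nat).
Local Notation S := {mpoly K[n]}.
Implicit Types (I P Q : S -> Prop) (C : {set 'I_n}).

Lemma eqI_sym P Q : eqI P Q -> eqI Q P.
Proof. by move=> h f; have [] := h f. Qed.

Lemma eqI_ass I P Q : eqI P Q -> ass I P -> ass I Q.
Proof.
move=> PQ [[[P0 PD PM] P1 Pp] [f hf]]; split; last first.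
  by exists f => g; split=> [/PQ/hf|/hf/PQ].
split; first split.
- exact/PQ.
- by move=> a b /PQ Pa /PQ Pb; apply/PQ/PD.
- by move=> r a /PQ Pa; apply/PQ/PM.
- by move/PQ.
- by move=> a b /PQ/Pp [] ?; [left | right]; apply/PQ.
Qed.

Lemma eqI_minass I P Q : eqI P Q -> minass I P -> minass I Q.
Proof.
move=> PQ [aP mP]; split; first exact: eqI_ass aP.
move=> R aR RQ f /PQ; apply: mP => // g /RQ; exact: (PQ g).2.
Qed.

Lemma subI_var_prime C C' : subI (var_prime (K := K) C) (var_prime C') <-> C \subset C'.
Proof.
split=> [h|/subsetP s f hf v /hf [i iC]]; last by exists i; rewrite ?s.
by apply/subsetP => i iC; apply/var_primeXi/h/var_primeXi.
Qed.

End EqualIdeals.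

Definition mpair n (i : 'I_n) a (j : 'I_n) b : 'X_{1..n} := (U_(i) *+ a + U_(j) *+ b)%MM.

Lemma mpairE n (i j k : 'I_n) a b : mpair i a j b k = ((i == k) * a + (j == k) * b)%N.
Proof. by rewrite mnmDE !mulmnE !mnm1E. Qed.

Lemma mpair_le n (i j : 'I_n) a b m : i != j ->
  (mpair i a j b <= m)%MM = (a <= m i)%N && (b <= m j)%N.
Proof.
move=> ne; apply/mnm_lepP/andP => [h|[hi hj] k].
  have := h i; have := h j; rewrite !mpairE !eqxx [j == i]eq_sym (negPf ne).
  by rewrite !mul0n !mul1n add0n addn0.
rewrite mpairE; have [<-|ik] := eqVneq i k.
  by rewrite eq_sym (negPf ne) mul1n mul0n addn0.
by have [<-|jk] := eqVneq j k; rewrite ?mul1n ?mul0n.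
Qed.

(** * Covers as associated primes, and weights from separation *)

Section CycleIdeals.
Variables (K : fieldType) (n : nat) (I : {mpoly K[n]} -> Prop) (D : nat).
Hypotheses (n6 : (6 <= n)%N) (monI : is_monomial_ideal I) (s2 : support2 I)
  (cycI : graph_is_cycle I) (bD : exponent_bound I D).
Implicit Types (i j k : 'I_n) (C : {set 'I_n}) (m w : 'X_{1..n}).

Local Notation cover := (vertex_cover (@cycle_edge n)).
Let idI : is_ideal I := monomial_ideal_ideal monI.

Lemma edge_neq i j : cycle_edge i j -> i != j.
Proof. by apply: cycle_edge_neq; apply: leq_trans n6. Qed.

Lemma mem_cycle_ideal m : I 'X_[m] -> exists i j a b,
  [/\ cycle_edge i j, I 'X_[mpair i a j b], (0 < a <= m i)%N, (0 < b <= m j)%N &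
      (a <= D)%N && (b <= D)%N].
Proof.
move=> /mingens_ex [g [mg /mnm_lepP le]]; have [i [j [ne gi gj z]]] := s2 mg.
exists i, j, (g i), (g j); split; rewrite ?gi ?gj ?le ?(bD mg) //.
  by apply/cycI; split=> //; exists g.
case: (mg) => Ig _; apply: ideal_lem Ig => //; apply/mnm_lepP => k; rewrite mpairE.
have [<-|ki] := eqVneq i k; first by rewrite mul1n leq_addr.
have [<-|kj] := eqVneq j k; first by rewrite mul1n leq_addl.
by rewrite z // eq_sym.
Qed.

Lemma edge_generator i j : cycle_edge i j -> exists a b,
  [/\ I 'X_[mpair i a j b], (a <= D)%N & (b <= D)%N].
Proof.
move=> /cycI [ne [g [mg [gi gj]]]]; exists (g i), (g j); rewrite !(bD mg).
have [i' [j' [_ _ _ z]]] := s2 mg; split=> //.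
have supp x : (0 < g x)%N -> (x == i') || (x == j').
  by apply: contraTT; rewrite negb_or -leqNgt leqn0 => /andP[xi xj]; rewrite z.
case: (mg) => Ig _; apply: ideal_lem Ig => //; apply/mnm_lepP => k; rewrite mpairE.
have [<-|ki] := eqVneq i k; first by rewrite mul1n leq_addr.
have [<-|kj] := eqVneq j k; first by rewrite mul1n leq_addl.
rewrite leqNgt; apply/negP => gk.
have := supp _ gi; have := supp _ gj; have := supp _ gk.
do 3!case/orP=> /eqP ?; subst; by rewrite eqxx in ne ki kj.
Qed.

Lemma edge_mem i j m : cycle_edge i j -> (D <= m i)%N -> (D <= m j)%N -> I 'X_[m].
Proof.
move=> e mi mj; have [a [b [Iab aD bD']]] := edge_generator e.
apply: ideal_lem Iab => //; rewrite mpair_le ?edge_neq //.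
by rewrite (leq_trans aD) // (leq_trans bD').
Qed.

(** An uncovered edge would have both exponents at least [D], putting ['X_[w]] in [I]. *)
Lemma witness_cover C w : ass_witness I D C w -> cover C.
Proof.
move=> [nIw _ Dw] i j e; have [|iC] := boolP (i \in C); first by left.
have [|jC] := boolP (j \in C); first by right.
by case: nIw; apply: edge_mem e (Dw _ iC) (Dw _ jC).
Qed.

(** The monomial with exponent [D] off [C] and 0 on [C] avoids [I] because every edge meets [C]. In
    a witness above it, a variable outside [C] already has exponent at least [D], so raising it
    cannot lead into [I]. *)
Lemma cover_witness C : cover C -> exists C' w, ass_witness I D C' w /\ C' \subset C.
Proof.
move=> cC; pose m := [multinom (if i \in C then 0 else D)%N | i < n].
have [|C' [w [aw /mnm_lepP le]]] := @ass_witness_ex _ _ I D m.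
  move=> /mem_cycle_ideal [i [j [a [b [e _ /andP[a0 ai] /andP[b0 bj] _]]]]].
  by move: (leq_trans a0 ai) (leq_trans b0 bj); rewrite !mnmE; have [->|->] := cC _ _ e.
exists C', w; split=> //; apply/subsetP => i iC'; apply: contraT => iC.
case: aw => nIw /(_ _ iC') Iwi _.
have Dw k : k \notin [set~ i] -> (D <= w k)%N.
  by rewrite !inE negbK => /eqP ->; move: (le i); rewrite mnmE (negPf iC).
case: (not_ideal_add_off (v := U_(i)%MM) idI bD nIw Dw) => // k; rewrite !inE mnm1E eq_sym.
by move/negPf ->.
Qed.

(** If [i] could be dropped, the smaller cover would contain the cover of an associated prime,
    contradicting minimality. *)
Lemma minass_irredundant C : minass I (var_prime C) -> cover C -> irredundant C.
Proof.
move=> [_ mP] cC i iC; apply: NNPP => no.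
have cCi : cover (C :\ i).
  move=> j k e; rewrite !inE; have [Ej|_] := eqVneq j i.
    right; apply/andP; split; first by rewrite -Ej eq_sym edge_neq.
    by apply: contraT => kC; case: no; exists k; rewrite // -Ej.
  have [Ek|_] := eqVneq k i; last exact: cC.
  left; apply: contraT => jC; case: no; exists j => //.
  by rewrite -Ek; apply: cycle_edge_sym.
have [C' [w [/(ass_witness_ass monI bD) aC' sub]]] := cover_witness cCi.
have sC : C' \subset C := subset_trans sub (subsetDl _ _).
have /subI_var_prime/subsetP /(_ _ iC) /(subsetP sub) := mP _ aC' ((subI_var_prime K _ _).2 sC).
by rewrite !inE eqxx.
Qed.

(* [I] is the intersection of its localizations at the minimal primes, read on monomials:
   setting the variables outside [C] to 1 amounts to making their exponents at least [D]. *)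
Definition separated := forall m, ~ I 'X_[m] -> exists C w,
  [/\ (m <= w)%MM, ~ I 'X_[w], (forall i, i \notin C -> (D <= w i)%N),
      cover C & irredundant C].

Lemma no_embedded_separated : no_embedded_primes I -> separated.
Proof.
move=> ne m /(ass_witness_ex D) [C [w [aw le]]]; have cC := witness_cover aw.
exists C, w; case: (aw) => nIw _ Dw; split=> //.
exact: minass_irredundant (ne _ (ass_witness_ass monI bD aw)) cC.
Qed.

Lemma ideal_pow1 f : ideal_pow I 1 f <-> I f.
Proof.
split=> [|If].
  by apply: ideal_genE => // _ [a [b [_ [Ib ->]]]]; case: idI => _ _; apply.
by apply: ideal_gen_sub; exists 1, f; rewrite mul1r.
Qed.

Lemma minass_cover P : minass I P ->
  exists C, [/\ eqI P (var_prime C), cover C & irredundant C].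
Proof.
move=> mP; case: (mP) => aP _; have [C [w [PC aw]]] := ass_var_prime monI bD aP.
have cC := witness_cover aw; exists C; split=> //.
exact: minass_irredundant (eqI_minass PC mP) cC.
Qed.

(** A monomial outside [I] is missed by the localization at some minimal prime; multiplying it by
    [D]-th powers of the variables off its cover, which are units there, keeps it outside [I]. *)
Lemma symbolic1_separated : subI (symb_pow I 1) (ideal_pow I 1) -> separated.
Proof.
move=> sub m nIm; have ns : ~ symb_pow I 1 'X_[m] by move/sub/ideal_pow1.
have [P [mP nP]] : exists P, minass I P /\ ~ contr_loc (ideal_pow I 1) P 'X_[m].
  apply: NNPP => no; apply: ns => P mP; apply: NNPP => nP; apply: no.
  by exists P.
have [C [PC cC iC]] := minass_cover mP.
pose e := [multinom (if i \in C then 0 else D)%N | i < n].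
exists C, (m + e)%MM; split=> //; first exact: lem_addr.
  move=> Ime; apply: nP; exists 'X_[e]; split; last first.
    by apply/ideal_pow1; rewrite -mpolyXD addmC.
  move/PC; apply/not_var_prime; exists e; split; first by rewrite msuppX inE eqxx.
  by move=> i h; rewrite mnmE h.
by move=> i h; rewrite mnmDE mnmE (negPf h) leq_addl.
Qed.

(** The standard linear weighting read on monomials; [std_lin_weightingE] proves the equivalence. *)
Definition weights (d : 'I_n -> nat) := (forall i, 0 < d i)%N /\
  forall m, I 'X_[m] <-> exists i j, [/\ cycle_edge i j, (d i <= m i)%N & (d j <= m j)%N].

(* The monomial [m] of the proof lies in every localization of [I] at a minimal prime, and
   its support contains no other edge than [i0, i1]. *)
Lemma separated_transfer i0 i1 i2 b : separated ->
  cycle_edge i1 i0 -> cycle_edge i1 i2 -> I 'X_[mpair i1 b i2 D] -> I 'X_[mpair i1 b i0 D].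
Proof.
move=> sep e0 e2 q2; have [->//|n02] := eqVneq i0 i2.
have [i3 [i4 [e34 nb2 n40 n41 /andP[ne40 ne41]]]] := cycle_extend_path n6 e0 e2 n02.
pose m := (mpair i1 b i0 D + U_(i4) *+ D)%MM.
have n10 := edge_neq e0.
have m0 : m i0 = D.
  by rewrite mnmDE mpairE mulmnE mnm1E eqxx (negPf n10) (negPf n40) !mul0n mul1n addn0.
have m1 : m i1 = b.
  rewrite mnmDE mpairE mulmnE mnm1E eqxx (negPf n41) eq_sym (negPf n10).
  by rewrite !mul0n mul1n !addn0.
have m4 : (D <= m i4)%N by rewrite mnmDE mulmnE mnm1E eqxx mul1n leq_addl.
have Im : I 'X_[m].
  (* If [i0] is in [C], it has a neighbour off [C], and both exponents are at least [D]. Otherwise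
     [i1] is in [C]: either [i2] is off [C] and [q2] applies, or irredundancy puts [i3] off [C] and
     the edge [i3], [i4] applies. *)
  apply: NNPP => /sep [C [w [/mnm_lepP le nIw Dw cC iC]]]; apply: nIw.
  have w0 : (D <= w i0)%N by rewrite -m0.
  have [/iC [j e /Dw wj]|i0C] := boolP (i0 \in C); first exact: edge_mem e w0 wj.
  have [i1C|] := cC _ _ e0; last by rewrite (negPf i0C).
  have [i2C|/Dw w2] := boolP (i2 \in C); last first.
    by apply: ideal_lem q2 => //; rewrite mpair_le ?edge_neq // w2 andbT -m1.
  have [j /nb2 [->|->]] := iC _ i2C; first by rewrite i1C.
  by move=> /Dw w3; apply: edge_mem e34 w3 (leq_trans m4 (le _)).
have [i [j [a [c [e Iac /andP[a0 ai] /andP[c0 cj] /andP[aD cD]]]]]] := mem_cycle_ideal Im.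
have supp k : (0 < m k)%N -> [|| k == i0, k == i1 | k == i4].
  rewrite mnmDE mpairE mulmnE mnm1E [i1 == k]eq_sym [i0 == k]eq_sym [i4 == k]eq_sym.
  by case: (k == i0); case: (k == i1); case: (k == i4).
have ne44 : ~~ cycle_edge i4 i4 by apply/negP => /edge_neq; rewrite eqxx.
have ne04 : ~~ cycle_edge i0 i4 by apply: contra ne40; apply: cycle_edge_sym.
have ne14 : ~~ cycle_edge i1 i4 by apply: contra ne41; apply: cycle_edge_sym.
have nij := edge_neq e.
apply: ideal_lem Iac => //; rewrite mpair_le //.
have /or3P[] := supp _ (leq_trans a0 ai); have /or3P[] := supp _ (leq_trans c0 cj);
  move=> /eqP Ej /eqP Ei; subst i j;
  rewrite ?(negPf ne44, negPf ne04, negPf ne14, negPf ne40, negPf ne41) ?eqxx // in e nij *.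
  by move: cj; rewrite m1 !mpairE !eqxx (negPf n10) (negPf nij) !mul0n !mul1n aD addn0.
by move: ai; rewrite m1 !mpairE !eqxx (negPf n10) eq_sym (negPf n10) !mul0n !mul1n cD addn0 => ->.
Qed.

(** [d i] is the least exponent of [i] that suffices when some neighbour has exponent [D]. By
    [separated_transfer] it suffices with either neighbour. *)
Lemma separated_weights : separated -> exists d, weights d.
Proof.
move=> sep.
have ex i : exists b, decb (exists2 j, cycle_edge i j & I 'X_[mpair i b j D]).
  have e : cycle_edge i (ordS i) by rewrite /cycle_edge /= eqxx.
  exists D; apply/decbP; exists (ordS i) => //; apply: (edge_mem e);
    by rewrite mpairE eqxx mul1n ?leq_addr ?leq_addl.
pose d i := ex_minn (ex i); exists d.
have dmin i j b : cycle_edge i j -> I 'X_[mpair i b j D] -> (d i <= b)%N.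
  by move=> e h; rewrite /d; case: ex_minnP => k _; apply; apply/decbP; exists j.
have dI i j : cycle_edge i j -> I 'X_[mpair i (d i) j D].
  rewrite /d; case: ex_minnP => k /decbP [j' e' h] _ e.
  exact: separated_transfer sep e e' h.
have dmem i j m : cycle_edge i j -> (d i <= m i)%N -> (D <= m j)%N -> I 'X_[m].
  by move=> e mi mj; apply: ideal_lem (dI _ _ e) => //; rewrite mpair_le ?edge_neq // mi.
split=> [i|m].
  rewrite lt0n; apply/eqP => di.
  have e : cycle_edge i (ordS i) by rewrite /cycle_edge /= eqxx.
  have /mem_cycle_ideal [k [l [a [b [e' _ /andP[a0 ak] /andP[b0 bl] _]]]]] := dI _ _ e.
  move: (leq_trans a0 ak) (leq_trans b0 bl) (edge_neq e'); rewrite di !mpairE !muln0 !add0n.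
  by do 2!case: eqP => // <-; rewrite eqxx.
split=> [/mem_cycle_ideal [i [j [a [b [e Iab /andP[_ ai] /andP[_ bj] /andP[aD bD']]]]]]|].
  have nij := edge_neq e; exists i, j; split=> //.
    apply: leq_trans ai; apply: (dmin _ j) => //; apply: ideal_lem Iab => //.
    by rewrite mpair_le // !mpairE !eqxx [j == i]eq_sym (negPf nij); lia.
  apply: leq_trans bj; apply: (dmin _ i); first exact: cycle_edge_sym.
  apply: ideal_lem Iab => //.
  by rewrite mpair_le // !mpairE !eqxx [j == i]eq_sym (negPf nij); lia.
(* In each localization one exponent becomes at least [D]: a neighbour of [i] if [i] is in [C], and
   [i] itself if not. Then [d i], respectively [d j], is enough for the other end. *)
move=> [i [j [e di dj]]]; apply: NNPP => /sep [C [w [/mnm_lepP le nIw Dw cC iC]]].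
have wi := leq_trans di (le i); have wj := leq_trans dj (le j).
apply: nIw; have [/iC [k e' /Dw wk]|/Dw Dwi] := boolP (i \in C); first exact: dmem e' wi wk.
exact: dmem (cycle_edge_sym e) wj Dwi.
Qed.

End CycleIdeals.

(** * Packing edges in bipartite graphs *)

Section Koenig.
Variables (V : finType) (e : rel V) (col : V -> bool) (b : V -> nat).
Hypotheses (esym : forall u v, e u v = e v u) (ecol : forall u v, e u v -> col u != col v).
Implicit Types (u v x y : V) (C : {set V}).
Local Open Scope nat_scope.

Let weight C := \sum_x (x \in C) * b x.

(* One step of the weighted Koenig theorem. The tight covers through a fixed vertex [u] are
   closed under the lattice operations of the bipartition; take the largest one on the side
   opposite to [u]. *)
Lemma bipartite_edge s : (forall C, vertex_cover e C -> s < weight C) ->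
  exists u v, [/\ e u v, 0 < b u, 0 < b v &
    forall C, vertex_cover e C -> s + (u \in C) + (v \in C) <= weight C].
Proof.
move=> hs.
(* If no tight cover has a vertex of positive [b], there is no tight cover, so all weigh at least
   [s + 2] and any edge with positive ends will do. *)
have [[C0 [u [cC0 tC0 uC0 bu]]]|no] := classic (exists C u,
    [/\ vertex_cover e C, weight C = s.+1, u \in C & 0 < b u]); last first.
  have [[u [v [euv bu bv]]]|noe] := classic (exists u v, [/\ e u v, 0 < b u & 0 < b v]); last first.
    have /hs : vertex_cover e [set x | b x == 0].
      move=> x y exy; rewrite !inE; have [|bx] := posnP (b x); first by left.
      have [|bY] := posnP (b y); first by right.
      by case: noe; exists x, y.
    rewrite /weight big1 // => x _; rewrite inE.
    by case: eqP => // ->.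
  exists u, v; split=> // C cC.
  have : weight C != s.+1.
    apply/eqP => tC; have : weight C != 0 by rewrite tC.
    rewrite sum_nat_eq0 => /forallPn [x /=]; case: (boolP (x \in C)) => // xC.
    by rewrite mul1n -lt0n => bx; apply: no; exists C, x.
  by have := hs _ cC; case: (u \in C); case: (v \in C); move: (weight C) => c; lia.
pose tight C := decb [/\ vertex_cover e C, weight C = s.+1 & u \in C].
pose side C := #|[set x in C | col x != col u]|.
have : tight C0 by apply/decbP.
case/(@arg_maxnP _ C0 tight side) => C /decbP [cC tC uC] Cmax.
(* Otherwise exchanging [u] for its neighbours with [b = 0] would give a cover of weight at most
   [s]. *)
have [v [euv vC bv]] : exists v, [/\ e u v, v \notin C & 0 < b v].
  apply: NNPP => no.
  have /hs : vertex_cover e (C :\ u :|: [set x | e u x && (b x == 0)]).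
    have nb x : e u x -> x \in C :\ u :|: [set x | e u x && (b x == 0)].
      move=> eux; rewrite !inE eux /=; have [xC|xC] := boolP (x \in C).
        by rewrite andbT; case: eqP => // E; move: (ecol eux); rewrite E eqxx.
      by rewrite andbF /= -leqn0 leqNgt; apply/negP => bx; apply: no; exists x.
    move=> x y exy; have [E|xu] := eqVneq x u; first by right; apply: nb; rewrite -E.
    have [E|yu] := eqVneq y u; first by left; apply: nb; rewrite -E esym.
    by case: (cC _ _ exy) => h; [left | right]; rewrite !inE ?xu ?yu h.
  rewrite ltnNge => /negP; apply; rewrite -ltnS -tC /weight.
  rewrite (bigD1 u) //= [ltnRHS](bigD1 u) //= uC mul1n -addSn leq_add //.
    rewrite !inE eqxx /=; case: (boolP (e u u)) => // euu.
    by move: (ecol euu); rewrite eqxx.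
  apply: leq_sum => x xu; rewrite !inE xu /=.
  by case: (x \in C) => //=; case: (e u x) => //=; case: eqP => // ->.
exists u, v; split=> // C1 cC1; have lt1 := hs _ cC1.
have [uC1|] := boolP (u \in C1); last by case: (v \in C1); move: (weight _) lt1 => c; lia.
have [vC1|] := boolP (v \in C1); last by move: (weight _) lt1 => c; lia.
have [tC1|] := eqVneq (weight C1) s.+1; last by move: (weight _) lt1 => c; lia.
(* The remaining case is a tight [C1] containing [u] and [v]. Then [M] and [J] are covers with the
   same total weight as [C] and [C1], so [M] is tight; it contains [u] and exceeds [C] on the
   opposite side by [v], against maximality. *)
pose M := [set x | if col x == col u then (x \in C) && (x \in C1) else (x \in C) || (x \in C1)].
pose J := [set x | if col x == col u then (x \in C) || (x \in C1) else (x \in C) && (x \in C1)].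
have colE x y : e x y -> (col y == col u) = (col x != col u).
  by move=> /ecol; case: (col x); case: (col y); case: (col u).
have cM : vertex_cover e M.
  move=> x y exy; rewrite !inE (colE _ _ exy).
  case: (cC _ _ exy) => ->; case: (cC1 _ _ exy) => ->; case: (col x == col u);
    rewrite ?orbT ?andbT /=; by [left | right | case: (_ \in _); [left | right]].
have cJ : vertex_cover e J.
  move=> x y exy; rewrite !inE (colE _ _ exy).
  case: (cC _ _ exy) => ->; case: (cC1 _ _ exy) => ->; case: (col x == col u);
    rewrite ?orbT ?andbT /=; by [left | right | case: (_ \in _); [left | right]].
have wMJ : weight M + weight J = weight C + weight C1.
  rewrite /weight -!big_split; apply: eq_bigr => x _ /=; rewrite !inE.
  by case: (x \in C); case: (x \in C1); case: (col x == col u); rewrite /=; lia.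
have tM : weight M = s.+1.
  have := hs _ cM; have := hs _ cJ; move: wMJ; rewrite tC tC1; clear; lia.
have colv : (col v == col u) = false by rewrite (colE _ _ euv) eqxx.
have /Cmax : tight M by apply/decbP; split=> //; rewrite inE eqxx uC uC1.
rewrite /= leqNgt => /negP; case; rewrite /side; apply: proper_card; apply/properP; split.
  by apply/subsetP => x; rewrite !inE => /andP[xC /negPf ->]; rewrite xC.
by exists v; rewrite !inE colv ?vC1 ?orbT ?(negPf vC).
Qed.

End Koenig.

(** * Powers and symbolic powers *)

Section IdealPowers.
Variables (K : fieldType) (n : nat) (I : {mpoly K[n]} -> Prop).
Implicit Types (m v w : 'X_{1..n}).

Lemma ideal_pow_ideal s : is_ideal (ideal_pow I s).
Proof. by case: s => [|s] /=; [split | apply: ideal_gen_ideal]. Qed.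

Lemma ideal_pow_mulX s m m' :
  ideal_pow I s 'X_[m] -> I 'X_[m'] -> ideal_pow I s.+1 'X_[m + m'].
Proof.
by move=> h h'; apply: ideal_gen_sub; exists 'X_[m], 'X_[m']; rewrite mpolyXD.
Qed.

(** A superadditive order function bounds powers from below. It serves with [c = 1] for a single
    cover and with [c = 2] for the set of all vertices. *)
Lemma ideal_pow_lower (phi : 'X_{1..n} -> nat) c s f : is_monomial_ideal I ->
  (forall m m', phi m + phi m' <= phi (m + m')%MM)%N ->
  (forall m, I 'X_[m] -> c <= phi m)%N ->
  ideal_pow I s f -> forall m, m \in msupp f -> (c * s <= phi m)%N.
Proof.
move=> monI phiD phiI; elim: s f => [|s IH] f /=; first by rewrite muln0.
move=> [k [r [g [hg ->]]]] m /msupp_sum_ex [i].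
have [a [b [Ia [Ib ->]]]] := hg i.
case/msuppM_ex => x [y [_ /msuppM_ex [z [t [za tb ->]]] ->]].
have h1 := IH _ Ia _ za; have h2 := phiI _ (monomial_ideal_msupp monI Ib tb).
have h3 := phiD z t; have h4 := phiD x (z + t)%MM.
by rewrite mulnS (leq_trans _ h4) // (leq_trans _ (leq_addl _ _)) // (leq_trans _ h3) // addnC leq_add.
Qed.

End IdealPowers.

(** * Cycle ideals with weights: embedded primes, even and odd cycles *)

Section WeightedCycleIdeals.
Variables (K : fieldType) (n : nat) (I : {mpoly K[n]} -> Prop) (D : nat).
Hypotheses (n6 : (6 <= n)%N) (monI : is_monomial_ideal I) (s2 : support2 I)
  (cycI : graph_is_cycle I) (bD : exponent_bound I D).
Implicit Types (i j k : 'I_n) (C : {set 'I_n}) (m w : 'X_{1..n}) (d : 'I_n -> nat).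

Local Notation cover := (vertex_cover (@cycle_edge n)).
Let idI : is_ideal I := monomial_ideal_ideal monI.
Let neq_edge i j : cycle_edge i j -> i != j := @edge_neq n n6 i j.

Lemma radicalX m : radical I 'X_[m] <->
  exists i j, [/\ cycle_edge i j, (0 < m i)%N & (0 < m j)%N].
Proof.
split=> [[k]|[i [j [e mi mj]]]].
  rewrite mpolyXn => /(mem_cycle_ideal monI s2 cycI bD).
  move=> [i [j [a [b [e _ /andP[a0 ai] /andP[b0 bj] _]]]]]; exists i, j.
  move: (leq_trans a0 ai) (leq_trans b0 bj); rewrite !mulmnE !muln_gt0.
  by move=> /andP[-> _] /andP[-> _].
exists D; rewrite mpolyXn; apply: (edge_mem n6 monI s2 cycI bD e);
  by rewrite mulmnE leq_pmull.
Qed.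

Lemma mingens_radical m : mingens (radical I) m <->
  exists i j, cycle_edge i j /\ m = mpair i 1 j 1.
Proof.
split=> [[/radicalX [i [j [e mi mj]]] mmin]|[i [j [e ->]]]].
  exists i, j; split=> //; apply/esym/mmin; first by rewrite [lem _ _]mpair_le ?neq_edge ?mi.
  by apply/radicalX; exists i, j; rewrite !mpairE !eqxx; split; rewrite // addn_gt0 ?orbT.
split; first by apply/radicalX; exists i, j; rewrite !mpairE !eqxx; split; rewrite // addn_gt0 ?orbT.
move=> m' le /radicalX [k [l [e' mk ml]]].
have le' := mnm_lepP le.
have nij := neq_edge e; have nkl := neq_edge e'.
have inij x : (0 < m' x)%N -> (x == i) || (x == j).
  move=> mx; move: (leq_trans mx (le' x)); rewrite mpairE [i == x]eq_sym [j == x]eq_sym.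
  by case: (x == i); case: (x == j).
have [m'i m'j] : (0 < m' i)%N /\ (0 < m' j)%N.
  move: (inij _ mk) (inij _ ml) => /orP[] /eqP Ek /orP[] /eqP El; subst k l => //;
    by rewrite eqxx in nkl.
have /mnm_lepP ge : (mpair i 1 j 1 <= m')%MM by rewrite mpair_le // m'i.
by apply/mnmP => x; apply/eqP; rewrite eqn_leq le' ge.
Qed.

Lemma weighted_radical d f : weighted (radical I) d f <->
  forall m, m \in msupp f ->
    exists i j, [/\ cycle_edge i j, (d i <= m i)%N & (d j <= m j)%N].
Proof.
have wE i j : cycle_edge i j -> wmnm d (mpair i 1 j 1) = mpair i (d i) j (d j).
  move=> e; apply/mnmP => k; rewrite mnmE !mpairE !muln1.
  by case: eqP => [<-|_]; case: eqP => [<-|_]; rewrite ?muln1 ?muln0 ?mul1n ?addn0 //; lia.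
pose A m := exists i j, cycle_edge i j /\ m = mpair i (d i) j (d j).
have -> : weighted (radical I) d f <-> ideal_gen (monomials A) f.
  split; (apply: ideal_genE; first exact: ideal_gen_ideal).
    move=> _ [m [/mingens_radical [i [j [e ->]]] ->]]; apply: ideal_gen_sub.
    by exists (mpair i (d i) j (d j)); rewrite wE //; split=> //; exists i, j.
  move=> _ [_ [[i [j [e ->]]] ->]]; apply: ideal_gen_sub.
  by exists (mpair i 1 j 1); rewrite wE //; split=> //; apply/mingens_radical; exists i, j.
rewrite ideal_gen_monomials; split=> h m /h.
  move=> [_ [[i [j [e ->]]]]]; rewrite mpair_le ?neq_edge // => /andP[? ?].
  by exists i, j.
move=> [i [j [e di dj]]]; exists (mpair i (d i) j (d j)).
by rewrite mpair_le ?neq_edge ?di //; split=> //; exists i, j.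
Qed.

Lemma std_lin_weightingE : has_std_lin_weighting I <-> exists d, weights I d.
Proof.
split=> [[d [d0 Ed]]|[d [d0 Ed]]]; exists d; split=> //.
  move=> m; split=> [/Ed/weighted_radical|h]; first by apply; rewrite msuppX inE eqxx.
  by apply/Ed/weighted_radical => m'; rewrite msuppX inE => /eqP ->.
move=> f; split=> [If|/weighted_radical h].
  by apply/weighted_radical => m /(monomial_ideal_msupp monI If)/Ed.
by apply: ideal_of_msupp => // m /h /Ed.
Qed.

Section Weights.
Variable d : 'I_n -> nat.
Hypothesis dI : weights I d.

Let d_gt0 i : (0 < d i)%N := dI.1 i.

Lemma mpair_weight_mem i j : cycle_edge i j -> I 'X_[mpair i (d i) j (d j)].
Proof.
move=> e; apply/dI.2; exists i, j; rewrite !mpairE !eqxx.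
by split; rewrite // mul1n ?leq_addr ?leq_addl.
Qed.

(** An edge putting [w + U_(i)] in [I] ends in [i], and its other end [l] already satisfies
    [d l <= w l]. Were [l] in [C], the step from [w] to [w + U_(l)] would enter [I] by raising an
    exponent that is large enough already. *)
Lemma witness_irredundant C w : ass_witness I D C w -> irredundant C.
Proof.
case=> nIw IwC _ i iC; apply: NNPP => no.
have [l [e dl]] : exists l, cycle_edge i l /\ (d l <= w l)%N.
  have /dI.2 [k [l [e dk dl]]] := IwC _ iC; have nkl := neq_edge e.
  move: dk dl; rewrite !mnmDE !mnm1E; have [Ek|ik] := eqVneq i k.
    by subst k; rewrite (negPf nkl) addn0 => _ dl; exists l.
  have [El|il] := eqVneq i l; last first.
    by rewrite !addn0 => dk dl; case: nIw; apply/dI.2; exists k, l.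
  by subst l; rewrite addn0 => dk _; exists k; split=> //; apply: cycle_edge_sym.
have lC : l \in C by apply: contraT => lC; case: no; exists l.
have /dI.2 [k [l' [e' dk dl']]] := IwC _ lC.
have drop x : (d x <= (w + U_(l))%MM x)%N -> (d x <= w x)%N.
  by rewrite mnmDE mnm1E; case: eqP => [<-|_]; rewrite ?addn0.
by apply: nIw; apply/dI.2; exists k, l'; split=> //; apply: drop.
Qed.

(** The covers of all associated primes are irredundant, so none properly contains another. *)
Lemma weights_no_embedded : no_embedded_primes I.
Proof.
move=> P aP; have [C [w [PC aw]]] := ass_var_prime monI bD aP.
apply: eqI_minass (eqI_sym PC) _; split; first exact: eqI_ass aP.
move=> Q aQ sQ; have [C' [w' [QC' aw']]] := ass_var_prime monI bD aQ.
have sub : C' \subset C by apply/(subI_var_prime K) => f /QC'/sQ.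
have cC' := witness_cover n6 monI s2 cycI bD aw'.
suff /(subI_var_prime K) h : C \subset C' by move=> f /h /QC'.
apply/subsetP => i /(witness_irredundant aw) [j e jC].
by case: (cC' _ _ e) => // /(subsetP sub); rewrite (negPf jC).
Qed.

(** Counts the factors ['X_i ^+ d i] of [m] over [i] in [C]; for a cover [C] it is at least 1 on
    [I]. *)
Definition wdeg C m := (\sum_i (i \in C) * (m i %/ d i))%N.

Lemma wdegD C m m' : (wdeg C m + wdeg C m' <= wdeg C (m + m')%MM)%N.
Proof.
rewrite /wdeg -big_split; apply: leq_sum => i _ /=.
by rewrite -mulnDr leq_mul2l mnmDE divnD ?d_gt0 // leq_addr orbT.
Qed.

Lemma wdeg_off C m v : off C v -> wdeg C (m + v)%MM = wdeg C m.
Proof.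
move=> ov; apply: eq_bigr => i _; case: (boolP (i \in C)) => // iC.
by rewrite mnmDE ov ?addn0.
Qed.

Lemma wdeg_subset C C' m : C \subset C' -> (wdeg C m <= wdeg C' m)%N.
Proof.
move=> /subsetP sub; apply: leq_sum => i _; rewrite leq_mul2r orbC.
by case: (boolP (i \in C)) => // /sub ->.
Qed.

Lemma wdeg_mpair C i j m : i != j -> (mpair i (d i) j (d j) <= m)%MM ->
  wdeg C m = (wdeg C (m - mpair i (d i) j (d j))%MM + (i \in C) + (j \in C))%N.
Proof.
move=> nij; rewrite mpair_le // => /andP[di dj].
have pick k : (\sum_x (x \in C) * (x == k) = (k \in C))%N.
  rewrite (bigD1 k) //= eqxx muln1 big1 ?addn0 // => x /negPf ->.
  by rewrite muln0.
rewrite -[in RHS](pick i) -(pick j) /wdeg -!big_split; apply: eq_bigr => k _ /=.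
rewrite -!mulnDr; congr (_ * _)%N; rewrite mnmBE mpairE.
have divB a b : (0 < b)%N -> (b <= a)%N -> (a %/ b = (a - b) %/ b + 1)%N.
  by move=> b0 le; rewrite -{1}(subnK le) divnDr // divnn b0.
have [Ek|_] := eqVneq i k.
  by subst k; rewrite [j == i]eq_sym (negPf nij) mul1n mul0n !addn0; apply: divB.
rewrite mul0n add0n addn0.
have [Ek|_] := eqVneq j k; first by subst k; rewrite mul1n; apply: divB.
by rewrite mul0n subn0 addn0.
Qed.

Lemma ideal_pow_sub_mpair s i j m : cycle_edge i j -> (d i <= m i)%N -> (d j <= m j)%N ->
  ideal_pow I s 'X_[m - mpair i (d i) j (d j)] -> ideal_pow I s.+1 'X_[m].
Proof.
move=> e di dj h; rewrite -(@submK _ (mpair i (d i) j (d j)) m) ?mpair_le ?neq_edge ?di //.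
exact: ideal_pow_mulX h (mpair_weight_mem e).
Qed.

Lemma cycle_edge_parity i j : ~~ odd n -> cycle_edge i j -> odd i != odd j.
Proof.
move=> evn; rewrite cycle_edgeE => /or4P[/eqP ->|/andP[/eqP E /eqP ->]|/eqP ->|/andP[/eqP E /eqP ->]].
- by rewrite /=; case: (odd i).
- by have := congr1 odd E; rewrite /= (negPf evn); case: (odd i).
- by rewrite /=; case: (odd j).
- by have := congr1 odd E; rewrite /= (negPf evn); case: (odd j).
Qed.

(** Parity 2-colours the cycle, so [bipartite_edge] supplies an edge whose generator can be split
    off, lowering every cover bound by at most the one unit available. *)
Lemma even_ideal_pow s m : ~~ odd n ->
  (forall C, cover C -> (s <= wdeg C m)%N) -> ideal_pow I s 'X_[m].
Proof.
move=> evn; elim: s m => [//|s IH] m hs.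
have esym i j : cycle_edge i j = cycle_edge j i by apply/idP/idP; apply: cycle_edge_sym.
have [i [j [e bi bj hC]]] := @bipartite_edge _ (@cycle_edge n) (fun i => odd i)
  (fun i => m i %/ d i)%N esym (fun i j => @cycle_edge_parity i j evn) s hs.
have le k : (0 < m k %/ d k)%N -> (d k <= m k)%N by rewrite divn_gt0.
apply: (ideal_pow_sub_mpair e (le _ bi) (le _ bj)); apply: IH => C cC.
have := hC _ cC; rewrite -/(wdeg C m) (@wdeg_mpair C i j) ?neq_edge ?mpair_le ?le ?neq_edge //.
by rewrite !leq_add2r.
Qed.

(** Each cover contains the cover [C'] of a minimal prime. Multipliers off [C'] leave [wdeg C']
    unchanged, so saturation carries the bound for [I^s] over to its localization at that prime. *)
Lemma even_symbolic s : ~~ odd n -> subI (symb_pow I s) (ideal_pow I s).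
Proof.
move=> evn f hf; apply: ideal_of_msupp; first exact: ideal_pow_ideal.
move=> m mf; apply: even_ideal_pow => // C cC.
have [C' [w [aw sub]]] := cover_witness monI s2 cycI bD cC.
apply: leq_trans (wdeg_subset _ sub).
have [u [/not_var_prime nu Iuf]] := hf _ (weights_no_embedded (ass_witness_ass monI bD aw)).
apply: (@mul_off_saturated _ _ (fun m => (s <= wdeg C' m)%N) C' f u) mf => //.
- by move=> a b h; apply: leq_trans (wdegD _ _ _); rewrite (leq_trans h) ?leq_addr.
- by move=> a b _ ob; rewrite wdeg_off.
move=> a auf; rewrite -[s]mul1n; apply: (ideal_pow_lower monI (@wdegD C') _ Iuf auf) => x.
move=> /dI.2 [i [j [e di dj]]].
have [] := witness_cover n6 monI s2 cycI bD aw e => h.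
  by rewrite /wdeg (bigD1 i) //= h mul1n ltn_addr // divn_gt0.
by rewrite /wdeg (bigD1 j) //= h mul1n ltn_addr // divn_gt0.
Qed.

(** Each vertex of [A] is matched with a neighbour off [C]. Neighbours may repeat, and exponents off
    [C] leave room for [s] uses of the same one. *)
Lemma irredundant_ideal_pow C s : irredundant C -> forall (A : {set 'I_n}) m,
  A \subset C -> (s <= #|A|)%N -> (forall i, i \in A -> d i <= m i)%N ->
  (forall j, j \notin C -> s * d j <= m j)%N -> ideal_pow I s 'X_[m].
Proof.
move=> iC; elim: s => [//|s IH] A m sub cA dA dC.
have [i iA] : exists i, i \in A by apply/card_gt0P; apply: leq_trans cA.
have iC' := subsetP sub _ iA; have [j e jC] := iC _ iC'.
have nij := neq_edge e.
have dj : (d j <= m j)%N by apply: leq_trans (dC _ jC); rewrite leq_pmull.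
apply: (ideal_pow_sub_mpair e (dA _ iA) dj); apply: (IH (A :\ i)).
- exact: subset_trans (subsetDl _ _) sub.
- by move: cA; rewrite (cardsD1 i A) iA.
- move=> k; rewrite !inE => /andP[ki kA]; rewrite mnmBE mpairE eq_sym (negPf ki).
  have -> : (j == k) = false by apply/eqP => E; rewrite E (subsetP sub _ kA) in jC.
  by rewrite !mul0n subn0 dA.
move=> k kC; rewrite mnmBE mpairE.
have -> : (i == k) = false by apply/eqP => E; rewrite -E iC' in kC.
have := dC _ kC; rewrite mulSn; case: eqP => [->|_]; rewrite ?mul1n ?mul0n ?subn0 => h.
  by rewrite leq_subRL ?(leq_trans (leq_addr _ _) h).
exact: leq_trans (leq_addl _ _) h.
Qed.

Lemma odd_symbolic : odd n -> exists2 s, (0 < s)%N & ~ subI (symb_pow I s) (ideal_pow I s).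
Proof.
move=> oddn; exists (uphalf n); first by rewrite uphalf_gt0; apply: leq_trans n6.
pose m := [multinom d i | i < n].
have odd2 := odd_uphalfK oddn.
move/(_ 'X_[m]) => sub.
(* An irredundant cover has at least [uphalf n] vertices, giving that many edges once the variables
   off it are inverted. In contrast, [I^s] requires total weighted degree [2 * uphalf n = n + 1],
   while [m] has only [n]. *)
have : ideal_pow I (uphalf n) 'X_[m].
  apply: sub => P mP; have [C [PC cC iC]] := minass_cover n6 monI s2 cycI bD mP.
  pose e := [multinom (if i \in C then 0 else uphalf n * d i)%N | i < n].
  exists 'X_[e]; split.
    move/PC; apply/not_var_prime; exists e; split; first by rewrite msuppX inE eqxx.
    by move=> i h; rewrite mnmE h.
  rewrite -mpolyXD; apply: (irredundant_ideal_pow iC (subxx C)).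
  - by rewrite leq_uphalf_double cover_card.
  - by move=> i h; rewrite mnmDE !mnmE h.
  - by move=> j h; rewrite mnmDE !mnmE (negPf h) leq_addr.
move=> /(@ideal_pow_lower _ _ _ (wdeg setT) 2 _ _ monI (@wdegD setT)) h.
have : (2 * uphalf n <= wdeg setT m)%N.
  apply: h; last by rewrite msuppX inE eqxx.
  move=> x /dI.2 [i [j [e di dj]]]; rewrite /wdeg (bigD1 i) //= (bigD1 j) /=; last first.
    by rewrite eq_sym neq_edge.
  by rewrite !inE !mul1n addnA (leq_trans _ (leq_addr _ _)) // -[2%N]/(1 + 1)%N leq_add ?divn_gt0.
rewrite mul2n odd2 ltnNge => /negP; apply.
have -> : (wdeg setT m = \sum_(i < n) 1)%N.
  by apply: eq_bigr => i _; rewrite !inE mnmE divnn d_gt0.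
by rewrite sum1_card card_ord.
Qed.

End Weights.
End WeightedCycleIdeals.

Theorem theorem3p4 (K : fieldType) (n : nat) (I : {mpoly K[n]} -> Prop) :
  (6 <= n)%N ->
  is_monomial_ideal I ->
  support2 I ->
  graph_is_cycle I ->
  (no_embedded_primes I <-> has_std_lin_weighting I) /\
  ((forall s : nat, (1 <= s)%N -> eqI (symb_pow I s) (ideal_pow I s))
     <-> (~~ odd n /\ has_std_lin_weighting I)).
Proof.
move=> n6 monI s2 cycI; have [D bD] := support2_exponent_bound s2.
have stdE := std_lin_weightingE n6 monI s2 cycI bD.
split; split=> [ne|].
- by apply/stdE; apply: (separated_weights n6 monI s2 cycI bD); apply: no_embedded_separated.
- by move=> /stdE [d dI]; apply: (weights_no_embedded n6 monI s2 cycI bD dI).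
(* Equality for [s = 1] already yields the weights; the other powers exclude odd [n]. *)
- have [d dI] : exists d, weights I d.
    apply: (separated_weights n6 monI s2 cycI bD); apply: symbolic1_separated => // f.
    by move/(ne 1%N isT).
  split; last by apply/stdE; exists d.
  apply/negP => /(odd_symbolic n6 monI s2 cycI bD dI) [s s0]; apply=> f.
  by move/(ne s s0).
move=> [evn /stdE [d dI]] s s0 f; split; first exact: (even_symbolic n6 monI s2 cycI bD dI evn).
move=> If P [[[_ P1 _] _] _]; exists 1; split=> //; by rewrite mul1r.
Qed.
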